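(* Suppose that the $|\mathcal I|=N_{\mathrm{sample}}$ patches are sampled independently from a fixed distribution, so that the $N_{\mathrm{sample}}$ identification outcomes are i.i.d. random variables. Assume in addition that $\mathrm{supp}(P)=\mathrm{supp}(Q)$, i.e., the sampled local patches are sufficient to identify all possible outcomes. Then for any $\eta>0$ there exists a constant $N_\eta>0$ such that whenever $N_{\mathrm{sample}}\ge N_\eta$, for any $\epsilon>0$, $$\mathbb P\Bigl(\max_{k:\ \mathbf s_k\in\mathcal S_{\mathrm{cand}}}|p_k-q_k|\le \sqrt{\frac{\epsilon+\eta}{2\,q_{\min}}+\frac{1-q_{\min}}{2\,q_{\min}}\,H(P)}\Bigr)\;\ge\;1-2\exp\Bigl(-\frac{2\,N_{\mathrm{sample}}\,\epsilon^2}{(\log q_{\min})^2}\Bigr)-\eta .$$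
   Context: Data are given on a uniform space-time grid with points $x_j$, $j=0,\dots,N_x$, and $t^n$, $n=0,\dots,N_t$, with spacings $\Delta x,\Delta t$. A local patch $\mathcal B_i$ is a rectangle $\{(x,t): x_{j_i}\le x\le x_{j_i}+B_x,\ t^{n_i}\le t\le t^{n_i}+B_t\}$ of fixed size ($B_x=3m_x\Delta x$, $B_t=m_t\Delta t$, where $m_x,m_t$ are positive integers computed from the data, the half-widths in grid steps of a test function). It is admissible if its starting indices satisfy $j_i\in\{0,\dots,N_x-3m_x-1\}$ and $n_i\in\{0,\dots,N_t-m_t-1\}$, so that it does not extend beyond the domain. A deterministic local identification algorithm (Local WeakIdent, a sparse regression on the weak form of $u_t=\sum_{l=1}^L c^{(l)}f_l$ over the patch, with a dictionary $f_1,\dots,f_L$ of candidate terms) assigns to each patch $\mathcal B_i$ a coefficient vector $\mathbf c_i\in\mathbb R^L$ and its support $\mathbf s_i$, the set of indices of its nonzero entries; this support is the identification outcome of the patch. One works within a single region of one equation, i.e. a subdomain in which the support of the governing equation does not change. $\mathcal I$ is the sample set of local patches, with $|\mathcal I|=N_{\mathrm{sample}}$. $\mathcal S_{\mathrm{cand}}$ is the set of distinct supports identified from the sampled patches, and $N_{\mathrm{cand}}=|\mathcal S_{\mathrm{cand}}|$. For $\mathbf s_k\in\mathcal S_{\mathrm{cand}}$, $p_k$ is the empirical probability of identifying $\mathbf s_k$ based on the sampled patches, i.e. $p_k=N_k/N_{\mathrm{sample}}$, where $N_k$ is the number of sampled patches whose identified support is $\mathbf s_k$. For a support $s_K$, $q_K$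 is the corresponding (true) probability of identifying $s_K$ under exhaustive sampling over all admissible patches. $\mathrm S_{\mathrm{true}}$ is the set of supports with nonzero true probability of being identified, so $\mathcal S_{\mathrm{cand}}\subset\mathrm S_{\mathrm{true}}$. The same index is used for the same support in both sets ($k=K$ whenever $\mathbf s_k=s_K$), the supports in $\mathcal S_{\mathrm{cand}}$ being the first $N_{\mathrm{cand}}$ supports of $\mathrm S_{\mathrm{true}}$; thus $q_k$ is the true probability of the support $\mathbf s_k$. $P=(p_k)_{\mathbf s_k\in\mathcal S_{\mathrm{cand}}}$ is the empirical distribution and $Q=(q_K)_{s_K\in\mathrm S_{\mathrm{true}}}$ is the true distribution; $\mathrm{supp}$ of a distribution denotes the set of outcomes to which it gives nonzero probability. $H(P)=-\sum_{k:\ \mathbf s_k\in\mathcal S_{\mathrm{cand}}}p_k\log p_k$ is the entropy of $P$, and $q_{\min}:=\min_{K:\ s_K\in\mathrm S_{\mathrm{true}}}q_K>0$ is the smallest nonzero probability of the distribution $Q$. *)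

(* Defs.v *)
From HB Require Import structures.
From mathcomp Require Import all_boot all_order all_algebra.
From mathcomp Require Import all_classical all_reals all_analysis.

Set Implicit Arguments.
Unset Strict Implicit.
Unset Printing Implicit Defensive.

Import Order.TTheory GRing.Theory Num.Theory.
Local Open Scope ring_scope.

(* The patch [x_j, x_j + 3 mx dx] * [t^n, t^n + mt dt] has a fixed size, so it
   is determined by its starting indices (j, n); it is admissible when
   j is in {0, ..., Nx - 3 mx - 1} and n is in {0, ..., Nt - mt - 1}. *)
Notation adm_patch Nx Nt mx mt :=
  ('I_(Nx - 3 * mx) * 'I_(Nt - mt))%type (only parsing).

Definition supp (T : finType) (R : nmodType) (f : T -> R) : {set T} :=
  [set x | f x != 0]%SET.

(* [coef b] is the coefficient vector that the identification algorithm assigns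
   to the patch b; the outcome for b is the support of that vector. *)
Definition identified (R : realType) (L : nat) (T : Type)
    (coef : T -> 'rV[R]_L) (b : T) : {set 'I_L} :=
  supp (fun l : 'I_L => coef b ord0 l).

Definition is_distribution (R : realType) (T : finType) (mu : T -> R) : Prop :=
  (forall b, 0 <= mu b) /\ \sum_b mu b = 1.

(* The true probability q_K of the support s, patches being drawn from mu. For
   mu uniform it is the fraction of admissible patches with support s. *)
Definition true_prob (R : realType) (L : nat) (T : finType)
    (coef : T -> 'rV[R]_L) (mu : T -> R) (s : {set 'I_L}) : R :=
  \sum_(b | identified coef b == s) mu b.

Definition S_true (R : realType) (L : nat) (T : finType)
    (coef : T -> 'rV[R]_L) (mu : T -> R) : {set {set 'I_L}} :=
  supp (true_prob coef mu).

(* For a distribution mu, S_true is nonempty and probabilities are at most 1, so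
   the default value 1 does not affect the minimum. *)
Definition q_min (R : realType) (L : nat) (T : finType)
    (coef : T -> 'rV[R]_L) (mu : T -> R) : R :=
  \big[Num.min/1]_(s in S_true coef mu) true_prob coef mu s.

(* Below, [S : 'I_N -> U] lists the outcomes of the N sampled patches. *)
Definition S_cand (U : finType) (N : nat) (S : 'I_N -> U) : {set U} :=
  [set S i | i : 'I_N]%SET.

Definition empirical (R : realType) (U : finType) (N : nat) (S : 'I_N -> U)
    (s : U) : R :=
  #|[set i : 'I_N | S i == s]%SET|%:R / N%:R.

Definition entropy (R : realType) (U : finType) (N : nat) (S : 'I_N -> U) : R :=
  - \sum_(s in S_cand S) empirical R S s * ln (empirical R S s).

(* The deviations are nonnegative, so the default value 0 does not affect the
   maximum as soon as N > 0. *)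
Definition max_dev (R : realType) (U : finType) (N : nat) (S : 'I_N -> U)
    (q : U -> R) : R :=
  \big[Num.max/0]_(s in S_cand S) `|empirical R S s - q s|.

(* X_0, ..., X_{N-1} are independent random elements of the finite set T (with
   its discrete sigma-algebra) with common law mu. Product rules for subfamilies
   are the cases where some of the E i are the full set. *)
Definition iid_sample (d : measure_display) (Omega : measurableType d)
    (R : realType) (Pr : probability Omega R) (T : finType) (mu : T -> R)
    (N : nat) (X : 'I_N -> Omega -> T) : Prop :=
  [/\ forall (i : 'I_N) (E : set T), measurable (X i @^-1` E)%classic,
      forall (i : 'I_N) (b : T), Pr (X i @^-1` [set b])%classic = (mu b)%:E
    & forall E : 'I_N -> set T,
        Pr (\bigcap_(i in [set: 'I_N]) (X i @^-1` E i))%classic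
        = (\prod_(i < N) Pr (X i @^-1` E i)%classic)%E].

Definition cond_prob (d : measure_display) (Omega : measurableType d)
    (R : realType) (Pr : probability Omega R) (A C : set Omega) : \bar R :=
  (Pr (A `&` C)%classic / Pr C)%E.

(* Main.v *)
Require Import Defs.
From HB Require Import structures.
From mathcomp Require Import all_boot all_order all_algebra.
From mathcomp Require Import all_classical all_reals all_analysis.
From mathcomp Require Import lra.

Set Implicit Arguments.
Unset Strict Implicit.
Unset Printing Implicit Defensive.

Import Order.TTheory GRing.Theory Num.Theory.
Local Open Scope ring_scope.

(** Since eps > 0, H(P) >= 0 and q_min <= 1, the radius in the theorem is at
    least r = sqrt (eta / (2 q_min)), which depends neither on N nor on the sample. It
    is therefore enough that the empirical frequencies converge in probability
    to q, with the event supp P = supp Q absorbed into the same estimate.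

    Put delta = min (r, q_min / 2), and call a sample good if
    |p_s - q_s| <= delta for every support s. Almost surely only outcomes of
    positive probability are sampled, and then a good sample satisfies
    supp P = supp Q, because delta < q_min ([supp_empirical]), and has maximal
    deviation at most r. By Chebyshev's inequality and a union bound over the
    2^L subsets of the dictionary, a sample is bad with probability at most
    2^L / (N delta^2) ([concentration]), which is at most eta once
    N >= 2^L / (eta delta^2). So the probability that the deviation bound and
    supp P = supp Q both hold is at least 1 - eta; dividing by the probability
    of the conditioning event can only increase it, and subtracting the
    exponential term only weakens the claim.

    As the patches form a finite set, the probability of any event that depends
    on the sample is a finite sum over its configurations
    f : {ffun 'I_N -> T}, weighted by the product of the mu (f i)
    ([iid_sample_prob]); Chebyshev's inequality is proved on such sums. *)

(** * Moments under a finite product law *)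

(** For mu of total mass 1: the mean of a product of functions of independent
    coordinates is the product of their means. *)
Lemma mean_prod (R : comPzSemiRingType) (T : finType) (mu : T -> R) (N : nat)
    (h : 'I_N -> T -> R) :
  \sum_(f : {ffun 'I_N -> T}) (\prod_i mu (f i)) * (\prod_i h i (f i))
  = \prod_i \sum_b mu b * h i b.
Proof.
rewrite bigA_distr_bigA; apply: eq_bigr => f _.
by rewrite big_split.
Qed.

Lemma sum_prod_weight (R : realType) (T : finType) (mu : T -> R) (N : nat) :
  is_distribution mu ->
  \sum_(f : {ffun 'I_N -> T}) \prod_i mu (f i) = 1.
Proof.
case=> _ mu1; rewrite -(bigA_distr_bigA (fun _ : 'I_N => mu)).
by rewrite big1.
Qed.

(** The variance of a sum of N independent copies of a centred variable is N
    times the variance of one copy. *)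
Lemma second_moment_sum (R : realType) (T : finType) (mu : T -> R)
    (N : nat) (g : T -> R) :
  is_distribution mu -> \sum_b mu b * g b = 0 ->
  \sum_(f : {ffun 'I_N -> T}) (\prod_i mu (f i)) * (\sum_i g (f i)) ^+ 2
  = N%:R * \sum_b mu b * g b ^+ 2.
Proof.
move=> [_ mu1] g0.
(* g (f i) * g (f j) written as a product over all coordinates k, which also
   covers the case i = j. *)
pose h (i j k : 'I_N) b :=
  (if k == i then g b else 1) * (if k == j then g b else 1).
have cross i j : \sum_(f : {ffun 'I_N -> T})
      (\prod_k mu (f k)) * (g (f i) * g (f j))
    = if j == i then \sum_b mu b * g b ^+ 2 else 0.
  transitivity (\prod_k \sum_b mu b * h i j k b).
    rewrite -mean_prod; apply: eq_bigr => f _; congr (_ * _).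
    by rewrite big_split /= -!big_mkcond /= !big_pred1_eq.
  rewrite (bigD1 i)//= /h eqxx; case: eqVneq => [->|ji].
    rewrite [X in _ * X]big1 ?mulr1 => [|k /negPf ki].
      by apply: eq_bigr => b _; rewrite expr2.
    by rewrite ki -[RHS]mu1; apply: eq_bigr => b _; rewrite !mulr1.
  under eq_bigr do rewrite mulr1.
  by rewrite g0 mul0r.
under eq_bigr => f _ do rewrite expr2 big_distrlr mulr_sumr /=.
rewrite exchange_big/= -[N in RHS]card_ord mulr_natl -sumr_const.
apply: eq_bigr => i _.
under eq_bigr => f _ do rewrite mulr_sumr /=.
rewrite exchange_big/=.
under eq_bigr => j _ do rewrite cross.
by rewrite -big_mkcond/= big_pred1_eq.
Qed.

(** * Concentration of the empirical frequencies *)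

Section empirical_deviation.
Variables (R : realType) (T U : finType) (mu : T -> R) (phi : T -> U).
Hypothesis mu_distr : is_distribution mu.

(** The law of phi when its argument has law mu. For phi the identified support
    it unfolds to [true_prob]. *)
Definition law (s : U) : R := \sum_(b | phi b == s) mu b.

Lemma law_ge0 s : 0 <= law s.
Proof. by case: mu_distr => mu0 _; apply: sumr_ge0. Qed.

Lemma law_le1 s : law s <= 1.
Proof.
case: mu_distr => mu0 <-; rewrite /law big_mkcond/=.
by apply: ler_sum => b _; case: ifP.
Qed.

Lemma empirical_sub_law (N : nat) (f : 'I_N -> T) s : (0 < N)%N ->
  empirical R (fun i => phi (f i)) s - law s
  = N%:R^-1 * \sum_i ((phi (f i) == s)%:R - law s).
Proof.
move=> N0; rewrite sumrB sumr_const card_ord mulrBr.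
rewrite -[law s *+ N]mulr_natl mulKf; last first.
  by rewrite pnatr_eq0 -lt0n.
congr (_ - _); rewrite /empirical mulrC; congr (_ * _).
rewrite -sum1_card natr_sum big_mkcond/=; apply: eq_bigr => i _.
by rewrite inE; case: eqP.
Qed.

(** The mean squared error is q_s (1 - q_s) / N; bounding the numerator by 1 is
    enough. *)
Lemma empirical_mse (N : nat) s : (0 < N)%N ->
  \sum_(f : {ffun 'I_N -> T})
    (\prod_i mu (f i)) * (empirical R (fun i => phi (f i)) s - law s) ^+ 2
  <= N%:R^-1.
Proof.
move=> N0; have N0R : 0 < N%:R :> R by rewrite ltr0n.
under eq_bigr => f _ do rewrite empirical_sub_law// exprMn mulrCA.
rewrite -mulr_sumr.
rewrite (@second_moment_sum _ _ mu N (fun b => (phi b == s)%:R - law s))//;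
  last first.
  under eq_bigr do rewrite mulrBr.
  rewrite sumrB -mulr_suml (proj2 mu_distr) mul1r /law [X in _ - X]big_mkcond/=.
  apply/eqP; rewrite subr_eq0; apply/eqP; apply: eq_bigr => b _.
  by case: eqP; rewrite ?mulr1 ?mulr0.
rewrite expr2 -mulrA mulKf ?gt_eqF//.
rewrite ler_piMr ?invr_ge0 ?(ltW N0R)//.
rewrite -[leRHS](proj2 mu_distr); apply: ler_sum => b _.
rewrite ler_piMr//; first exact: (proj1 mu_distr).
have := law_ge0 s; have := law_le1 s; case: eqP => _ /=; nra.
Qed.

(** Chebyshev's inequality with a union bound over the outcomes, for an event P
    that is only required to contain the good configurations of nonzero
    weight. *)
Lemma concentration (N : nat) (delta : R) (P : pred {ffun 'I_N -> T}) :
  (0 < N)%N -> 0 < delta ->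
  (forall f : {ffun 'I_N -> T}, (forall i, mu (f i) != 0) ->
    (forall s, `|empirical R (fun i => phi (f i)) s - law s| <= delta) ->
    P f) ->
  1 - #|U|%:R / (N%:R * delta ^+ 2) <= \sum_(f | P f) \prod_i mu (f i).
Proof.
move=> N0 d0 goodP.
have W0 (f : {ffun 'I_N -> T}) : 0 <= \prod_i mu (f i).
  by apply: prodr_ge0 => i _; apply: (proj1 mu_distr).
have := sum_prod_weight N mu_distr; rewrite (bigID P)/= => W1.
rewrite lerBlDr -[leLHS]W1 lerD2l.
pose dev (f : {ffun 'I_N -> T}) s :=
  empirical R (fun i => phi (f i)) s - law s.
(* The indicator of the complement of P is at most the sum over s of
   dev f s ^+ 2 / delta ^+ 2, except where the weight of f vanishes. *)
apply: (@le_trans _ _ (\sum_(s : U) (delta ^+ 2)^-1 *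
    \sum_(f : {ffun 'I_N -> T}) (\prod_i mu (f i)) * dev f s ^+ 2)); last first.
  rewrite -mulr_sumr [in leRHS]invfM [leRHS]mulrA [leRHS]mulrC.
  rewrite ler_pM2l ?invr_gt0 ?exprn_gt0//.
  rewrite mulr_natl -sumr_const; apply: ler_sum => s _.
  exact: empirical_mse.
rewrite -mulr_sumr exchange_big/= mulr_sumr big_mkcond/=.
apply: ler_sum => f _; rewrite -mulr_sumr mulrCA.
have S0 : 0 <= (delta ^+ 2)^-1 * \sum_i dev f i ^+ 2.
  rewrite mulr_ge0 ?invr_ge0 ?sqr_ge0// sumr_ge0// => s _; exact: sqr_ge0.
case: ifPn => nPf; last by rewrite mulr_ge0.
have [->|Wf] := eqVneq (\prod_i mu (f i)) 0; first by rewrite mul0r.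
have muf i : mu (f i) != 0 by move/prodf_neq0: Wf => /(_ i isT).
have [s ds] : exists s, delta < `|dev f s|.
  apply: contrapT => /forallNP nds; move/negP: nPf; apply.
  by apply: goodP => // s; rewrite leNgt; apply/negP; apply: nds.
rewrite ler_peMr// mulrC ler_pdivlMr ?exprn_gt0// mul1r.
rewrite (bigD1 s)//= -[leLHS]addr0 lerD//; last first.
  by apply: sumr_ge0 => t _; apply: sqr_ge0.
by rewrite -(real_normK (num_real (dev f s))) ler_sqr ?nnegrE ?(ltW d0)// ltW.
Qed.

(** Every event that depends on an i.i.d. sample is measurable, and its
    probability is computed on the finite set of configurations. *)
Lemma iid_sample_prob (d : measure_display) (Omega : measurableType d)
    (Pr : probability Omega R) (N : nat) (X : 'I_N -> Omega -> T)
    (P : pred {ffun 'I_N -> T}) : iid_sample Pr mu X ->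
  measurable [set w | P [ffun i => X i w]]%classic /\
  Pr [set w | P [ffun i => X i w]]%classic
  = (\sum_(f | P f) \prod_i mu (f i))%:E.
Proof.
move=> [mX lX iX].
pose cyl (f : {ffun 'I_N -> T}) :=
  (\bigcap_(i in [set: 'I_N]) (X i @^-1` [set f i]))%classic.
have PE : [set w | P [ffun i => X i w]]%classic
    = (\bigcup_(f in [set f | P f]) cyl f)%classic.
  apply/seteqP; split => [w Pw|w [f Pf cf]] /=.
    by exists [ffun i => X i w] => // i _; rewrite /= ffunE.
  suff -> : [ffun i => X i w] = f by [].
  by apply/ffunP => i; rewrite ffunE; apply: cf.
have finP : finite_set [set f | P f] by apply: finite_finset.
have mcyl f : measurable (cyl f).
  by apply: fin_bigcap_measurable => // i _; apply: mX.
rewrite PE; split; first exact: fin_bigcup_measurable.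
rewrite measure_fin_bigcup//; last first.
  move=> f g _ _ [w [cf cg]]; apply/ffunP => i.
  by rewrite -(cf i I) -(cg i I).
rewrite (fsbigE (enum P)) ?enum_uniq//=; last first.
- by move=> f Pf; rewrite mem_enum -topredE /= Pf.
- by move=> f /=; rewrite mem_enum.
rewrite big_enum_cond/= -sumEFin; apply: eq_big => [f|f _].
  have -> : (f \in P) = P f by [].
  by case: (boolP (P f)) => Pf //=; apply: mem_set.
rewrite /cyl iX -prodEFin; apply: eq_bigr => i _; exact: lX.
Qed.

(** An outcome of probability zero cannot occur among points of positive mass,
    and one of probability above delta must occur if its frequency is
    delta-accurate. *)
Lemma supp_empirical (N : nat) (f : 'I_N -> T) (delta : R) :
  (forall i, mu (f i) != 0) ->
  (forall s, law s != 0 -> delta < law s) ->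
  (forall s, `|empirical R (fun i => phi (f i)) s - law s| <= delta) ->
  supp (empirical R (fun i => phi (f i))) = supp law.
Proof.
move=> muf lawd dev; apply/setP => s; rewrite !inE.
have [ls0|ls0] := eqVneq (law s) 0.
  have mu0 b : phi b == s -> mu b = 0.
    by apply: (psumr_eq0P _ ls0) => c _; apply: (proj1 mu_distr).
  rewrite /empirical (_ : [set i | phi (f i) == s]%SET = finset.set0).
    by rewrite cards0 mul0r eqxx.
  apply/setP => i; rewrite !inE; apply/negP => /mu0 /eqP.
  by apply/negP.
apply/eqP => es0; have := dev s.
rewrite es0 sub0r normrN ger0_norm ?law_ge0// leNgt.
by rewrite lawd.
Qed.

End empirical_deviation.

(** * Bounds on the quantities of the theorem *)

Lemma q_min_le (R : realType) (L : nat) (T : finType) (coef : T -> 'rV[R]_L)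
    (mu : T -> R) s :
  true_prob coef mu s != 0 -> q_min coef mu <= true_prob coef mu s.
Proof. by move=> qs0; apply: bigmin_le_cond; rewrite inE. Qed.

Lemma q_min_le1 (R : realType) (L : nat) (T : finType) (coef : T -> 'rV[R]_L)
    (mu : T -> R) : q_min coef mu <= 1.
Proof. exact: bigmin_le_id. Qed.

Lemma q_min_gt0 (R : realType) (L : nat) (T : finType) (coef : T -> 'rV[R]_L)
    (mu : T -> R) : is_distribution mu -> 0 < q_min coef mu.
Proof.
move=> mu_distr; apply: lt_bigmin => // s; rewrite inE => qs0.
by rewrite lt_def qs0 /=; apply: (law_ge0 _ mu_distr).
Qed.

Lemma entropy_ge0 (R : realType) (U : finType) (N : nat) (S : 'I_N -> U) :
  0 <= entropy R S.
Proof.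
rewrite oppr_ge0; apply: sumr_le0 => s _.
apply: mulr_ge0_le0; first by rewrite divr_ge0.
apply: ln_le0; rewrite /empirical.
have [->|N0] := eqVneq (N%:R : R) 0; first by rewrite invr0 mulr0.
rewrite ler_pdivrMr ?lt_def ?N0 ?ler0n// mul1r ler_nat -[leqRHS]card_ord.
exact: max_card.
Qed.

Lemma max_dev_le (R : realType) (U : finType) (N : nat) (S : 'I_N -> U)
    (q : U -> R) (r : R) :
  0 <= r -> (forall s, `|empirical R S s - q s| <= r) -> max_dev S q <= r.
Proof. by move=> r0 dev; apply: bigmax_le. Qed.

(** Also valid when Pr C = 0, where (Pr C)^-1 = +oo. *)
Lemma cond_prob_ge (d : measure_display) (Omega : measurableType d)
    (R : realType) (Pr : probability Omega R) (A C : set Omega) :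
  measurable C -> (Pr (A `&` C)%classic <= cond_prob Pr A C)%E.
Proof.
move=> mC; rewrite /cond_prob lee_pemulr ?measure_ge0// inve_ge1 ?measure_ge0//.
exact: probability_le1.
Qed.

(* MathComp-Analysis. In \bar R, 0^-1 = +oo and expeR (-oo) = 0, so that when
   q_min = 1 (hence log q_min = 0) the exponential term is its limit value 0. *)
Theorem theorem4p1p2 (R : realType) (Nx Nt mx mt L : nat)
    (mx_gt0 : (0 < mx)%N) (mt_gt0 : (0 < mt)%N)
    (coef : adm_patch Nx Nt mx mt -> 'rV[R]_L)
    (mu : adm_patch Nx Nt mx mt -> R) (mu_distr : is_distribution mu)
    (eta : R) (eta_gt0 : 0 < eta) :
  exists Neta : nat, (0 < Neta)%N /\
    forall N : nat, (Neta <= N)%N ->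
    forall (d : measure_display) (Omega : measurableType d)
      (Pr : probability Omega R) (B : 'I_N -> Omega -> adm_patch Nx Nt mx mt),
    iid_sample Pr mu B ->
    forall eps : R, 0 < eps ->
    let S w := fun i : 'I_N => identified coef (B i w) in
    let q := true_prob coef mu in
    let qm := q_min coef mu in
    (1 - 2%:E * expeR (- ((2 * N%:R * eps ^+ 2)%:E / (ln qm ^+ 2)%:E)) - eta%:E
     <= cond_prob Pr
          [set w | (max_dev (S w) q
             <= Num.sqrt ((eps + eta) / (2 * qm)
                          + (1 - qm) / (2 * qm) * entropy R (S w)))%R]%classic
          [set w | supp (empirical R (S w)) = supp q]%classic)%E.
Proof.
set q := true_prob coef mu; set qm := q_min coef mu.
have qm_gt0 : 0 < qm by apply: q_min_gt0.
have qm_le1 : qm <= 1 by apply: q_min_le1.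
pose r := Num.sqrt (eta / (2 * qm)).
have r_gt0 : 0 < r by rewrite sqrtr_gt0 divr_gt0// mulr_gt0.
pose delta := Num.min r (qm / 2).
have delta_gt0 : 0 < delta by rewrite lt_min r_gt0 divr_gt0.
have delta_le_r : delta <= r by rewrite ge_min lexx.
have delta_lt_qm : delta < qm.
  by rewrite gt_min; apply/orP; right; rewrite ltr_pdivrMr// ltr_pMr// ltr1n.
pose c := #|{set 'I_L}|%:R / (eta * delta ^+ 2).
have c_ge0 : 0 <= c by rewrite divr_ge0// mulr_ge0 ?sqr_ge0// ltW.
(* The threshold N >= c makes the Chebyshev bound at most eta. *)
exists (Num.bound c).+1; split => // N N_ge d Omega Pr B B_iid eps eps_gt0.
cbv zeta.
have N_gt0 : (0 < N)%N by apply: leq_trans N_ge.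
have c_le_N : c <= N%:R.
  apply: (le_trans (ltW (archi_boundP c_ge0))).
  by rewrite ler_nat ltnW.
pose outcomes (f : {ffun 'I_N -> adm_patch Nx Nt mx mt}) i :=
  identified coef (f i).
pose small f := max_dev (outcomes f) q
  <= Num.sqrt ((eps + eta) / (2 * qm)
               + (1 - qm) / (2 * qm) * entropy R (outcomes f)).
pose full f := supp (empirical R (outcomes f)) == supp q.
have SE w : (fun i => identified coef (B i w)) = outcomes [ffun i => B i w].
  by apply/funext => i; rewrite /outcomes ffunE.
set A := (X in cond_prob _ X _); set C := (X in cond_prob _ _ X).
have CE : C = [set w | full [ffun i => B i w]]%classic.
  by apply/seteqP; split => w /=; rewrite /C /full /= SE => /eqP.
have ACE : (A `&` C = [set w | [pred f | small f && full f]
    [ffun i => B i w]])%classic.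
  rewrite CE; apply/seteqP; split => w /=; rewrite /A /= SE.
    by case=> Aw Cw; apply/andP.
  by move/andP.
have mC : measurable C.
  by rewrite CE; have [] := iid_sample_prob full B_iid.
apply: le_trans (cond_prob_ge Pr A mC).
have [_ PAC] := iid_sample_prob [pred f | small f && full f] B_iid.
rewrite ACE PAC.
apply: (@le_trans _ _ (1 - eta)%:E).
  by rewrite EFinB leeB// -[leRHS]sube0 leeB// mule_ge0// ?expeR_ge0//.
rewrite lee_fin.
apply: le_trans
  (concentration (phi := identified coef) mu_distr N_gt0 delta_gt0 _).
  rewrite lerB// ler_pdivrMr ?mulr_gt0 ?ltr0n ?exprn_gt0//.
  by rewrite mulrCA -ler_pdivrMr// mulr_gt0// exprn_gt0.
move=> f muf dev; apply/andP; split.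
  apply: max_dev_le; first exact: sqrtr_ge0.
  move=> s; apply: (le_trans (dev s)); apply: (le_trans delta_le_r).
  apply: ler_wsqrtr; apply: ler_wpDr.
    by rewrite mulr_ge0 ?entropy_ge0// divr_ge0 ?subr_ge0// mulr_ge0// ltW.
  by rewrite ler_pM2r ?invr_gt0 ?mulr_gt0// lerDr ltW.
apply/eqP; apply: (supp_empirical mu_distr muf _ dev) => s qs0.
by apply: (lt_le_trans delta_lt_qm); apply: q_min_le.
Qed.
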